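(* Assume $2^{<\mathfrak{c}} = \mathfrak{c}$. Let $X$ be a Lindelöf Hausdorff space such that $\psi(X) \leq \mathfrak{c}$ and $\hat{F}(X) \cdot b(X) \leq \mathfrak{c}$. Then $|X| \leq \mathfrak{c}$.
   Context: All spaces are Hausdorff. $\mathfrak{c} = 2^{\aleph_0}$ and $2^{<\mathfrak{c}} = \sup\{2^\lambda : \lambda < \mathfrak{c}\}$. $\psi(X)$ is the pseudocharacter of $X$: the least infinite cardinal $\kappa$ such that every point of $X$ is the intersection of at most $\kappa$ open sets. A sequence $\{x_\alpha : \alpha < \kappa\}$ of points of $X$ ($\kappa$ an ordinal) is free if for every $\gamma < \kappa$ we have $\overline{\{x_\alpha : \alpha \leq \gamma\}} \cap \overline{\{x_\alpha : \alpha > \gamma\}} = \emptyset$; a subset of $X$ is called a free sequence if it can be enumerated as one. $\hat{F}(X) = \min\{\kappa : \text{if } A \subset X \text{ and } |A| = \kappa \text{ then } A \text{ is not a free sequence}\}$. $b(X) = \sup\{|\overline{F}| : F \subset X \text{ is a free sequence}\}$. *)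

(* Defs.v *)
From mathcomp Require Import all_boot.
From mathcomp Require Import all_classical topology.
From mathcomp Require wochoice.

Set Implicit Arguments.
Unset Strict Implicit.
Unset Printing Implicit Defensive.

Local Open Scope classical_set_scope.
Local Open Scope card_scope.

(* A cardinal is represented by any type of that cardinality, and a class of
   cardinals by a predicate on types. *)

Definition is_card_min (S : Type -> Prop) (K : Type) : Prop :=
  S K /\ forall L : Type, S L -> [set: K] #<= [set: L].

(* A representative of the least cardinal in S; the value [void] is only used
   when S is empty, see [card_min_exists]. *)
Definition card_min (S : Type -> Prop) : Type :=
  if pselect (exists K, is_card_min S K) is left h then projT1 (cid h)
  else void.

Definition card_sup (S : Type -> Prop) : Type :=
  card_min (fun K => forall L : Type, S L -> [set: L] #<= [set: K]).

Lemma card_leTP (T U : Type) :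
  [set: T] #<= [set: U] <-> exists f : T -> U, injective f.
Proof.
split=> [/card_leP[f]|[f finj]].
  exists (fun x => sval (f (SigSub (mem_set (I : [set: T] x))))) => x y fxy.
  have /(inj (mem_setT _) (mem_setT _))/(congr1 val) // :
    f (SigSub (mem_set (I : [set: T] x))) = f (SigSub (mem_set (I : [set: T] y))).
  exact: val_inj.
suff: $|{injfun [set: T] >-> [set: U]}| by case=> g; exact: inj_card_le.
by apply/injfunPex; exists f => // x y _ _; exact: finj.
Qed.

Lemma card_family_min (I : Type) (T : I -> Type) : inhabited I ->
  exists i, forall j, [set: T i] #<= [set: T j].
Proof.
move=> [i0]; pose E := forall i, T i.
(* a maximal set of choice functions that pairwise differ everywhere *)
pose indep (M : set E) :=
  forall f g : E, M f -> M g -> forall i, f i = g i -> f = g.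
have [|M [iM maxM]] := @Zorn_bigcup E indep.
  move=> F FI Ftot f g [A FA Af] [B FB Bg] i.
  have [AB|BA] := Ftot A B FA FB.
  - exact: (FI _ FB _ _ (AB _ Af) Bg).
  - exact: (FI _ FA _ _ Af (BA _ Bg)).
have [[i sur_i]|nsur] := pselect (exists i, forall y, exists2 f, M f & f i = y).
  exists i => j; apply/card_leTP.
  exists (fun y => s2val (cid2 (sur_i y)) j) => y z.
  case: (cid2 (sur_i y)) => f Mf fy; case: (cid2 (sur_i z)) => g Mg gz /=.
  by move/(iM _ _ Mf Mg) => fg; rewrite -fy -gz fg.
have ex i : exists y, forall f, M f -> f i <> y.
  apply: contrapT => nex; apply: nsur; exists i => y.
  apply: contrapT => ny; apply: nex; exists y => f Mf fy.
  by apply: ny; exists f.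
pose g : E := fun i => projT1 (cid (ex i)).
have gM i f : M f -> f i <> g i by exact: (projT2 (cid (ex i))).
exfalso; apply: (maxM (M `|` [set g])).
  split=> [f Mf|/(_ g) /= gMM]; first by left.
  exact: (gM i0 g (gMM (or_intror erefl))).
move=> f f' [Mf|->] [Mf'|->] i //; first exact: iM.
- by move/(gM i _ Mf).
- by move/esym/(gM i _ Mf').
Qed.

Lemma card_min_exists (S : Type -> Prop) :
  (exists K, S K) -> exists K, is_card_min S K.
Proof.
move=> [K0 SK0].
(* the cardinals of S below K0, represented by images of maps into K0 *)
pose small (A : K0 -> bool) := exists2 L : Type, S L &
  [set: L] #<= [set: {x | A x}] /\ [set: {x | A x}] #<= [set: L].
have smallP L : S L -> [set: L] #<= [set: K0] ->
    exists2 A, small A & [set: {x | A x}] #<= [set: L].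
  move=> SL /card_leTP[f finj]; pose A y := `[< exists l, f l = y >].
  have Af l : A (f l) by apply/asboolP; exists l.
  have AL : [set: {x | A x}] #<= [set: L].
    apply/card_leTP; exists (fun y => projT1 (cid (asboolW (svalP y)))) => y z.
    case: cid => l ly; case: cid => l' l'z /= ll'.
    by apply: val_inj; rewrite /= -ly -l'z ll'.
  exists A => //; exists L => //; split=> //; apply/card_leTP.
  by exists (fun l => exist _ (f l) (Af l)) => l l' [] /finj.
have [A0 sA0 _] := smallP K0 SK0 (card_lexx _).
have [[A [K SK [KA AK]]] /= Amin] := @card_family_min {A | small A}
  (fun A => {x | sval A x}) (inhabits (exist _ A0 sA0)).
exists K; split=> // L SL.
have [[/(_ false)//|/(_ true) LK]] := @card_family_min bool
  (fun b => if b then K else L) (inhabits true).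
have LK0 : [set: L] #<= [set: K0].
  apply: card_le_trans (card_le_trans LK KA) _.
  by apply/card_leTP; exists sval => x y; exact: val_inj.
have [B sB BL] := smallP L SL LK0.
exact: card_le_trans KA (card_le_trans (Amin (exist _ B sB)) BL).
Qed.

Lemma card_minP (S : Type -> Prop) :
  (exists K, S K) -> is_card_min S (card_min S).
Proof.
move=> /card_min_exists ex; rewrite /card_min.
by case: pselect => [h|//]; exact: (projT2 (cid h)).
Qed.

Lemma card_supP (S : Type -> Prop) :
  (exists K : Type, forall L : Type, S L -> [set: L] #<= [set: K]) ->
  is_card_min (fun K => forall L : Type, S L -> [set: L] #<= [set: K])
    (card_sup S).
Proof. exact: card_minP. Qed.

Definition continuum : Type := nat -> bool.

(* 2^{<K} = sup {2^L : L < K} *)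
Definition two_pow_lt (K : Type) : Type :=
  card_sup (fun P => exists L : Type,
    [/\ [set: L] #<= [set: K], [set: L] #!= [set: K] &
        [set: P] #= [set: L -> bool]]).

Definition lindelof_space (X : topologicalType) : Prop :=
  forall F : set (set X), F `<=` open -> \bigcup_(U in F) U = [set: X] ->
  exists G : set (set X),
    [/\ G `<=` F, countable G & \bigcup_(U in G) U = [set: X]].

Definition pseudocharacter (X : topologicalType) : Type :=
  card_min (fun K => infinite_set [set: K] /\
    forall x : X, exists F : set (set X),
      [/\ F `<=` open, F #<= [set: K] & \bigcap_(U in F) U = [set x]]).

(* The index set of a transfinite sequence is a type I well-ordered by the
   reflexive relation R. *)
Definition free_sequence (X : topologicalType) (I : Type) (R : rel I)
    (x : I -> X) : Prop :=
  forall c : I, closure (x @` [set a | R a c]) `&`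
                closure (x @` [set a | ~~ R a c]) = set0.

Definition is_free_sequence (X : topologicalType) (A : set X) : Prop :=
  exists (I : Type) (R : rel I) (x : I -> X),
    [/\ wochoice.well_order R, free_sequence R x & range x = A].

Definition Fhat (X : topologicalType) : Type :=
  card_min (fun K => forall A : set X, A #= [set: K] -> ~ is_free_sequence A).

Definition bsup (X : topologicalType) : Type :=
  card_sup (fun K => exists F : set X,
    is_free_sequence F /\ [set: K] #= closure F).

(* None of the classes of cardinals used above is empty. *)

Lemma two_pow_ltP (K : Type) :
  is_card_min (fun Q => forall P : Type, (exists L : Type,
    [/\ [set: L] #<= [set: K], [set: L] #!= [set: K] &
        [set: P] #= [set: L -> bool]]) -> [set: P] #<= [set: Q])
    (two_pow_lt K).
Proof.
apply: card_supP; exists (K -> bool) => P [L [/card_leTP[f finj] _ PL]].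
rewrite (card_le_eql PL); apply/card_leTP.
exists (fun u k => `[< exists2 l, f l = k & u l >]) => u v uv.
apply/funext => l; have := congr1 (@^~ (f l)) uv.
have E (w : L -> bool) : `[< exists2 l', f l' = f l & w l' >] = w l.
  by apply/asboolP/idP => [[l' /finj ->]//|wl]; exists l.
by rewrite /= !E.
Qed.

Lemma pseudocharacterP (X : topologicalType) : hausdorff_space X ->
  is_card_min (fun K => infinite_set [set: K] /\
    forall x : X, exists F : set (set X),
      [/\ F `<=` open, F #<= [set: K] & \bigcap_(U in F) U = [set x]])
    (pseudocharacter X).
Proof.
move=> hX; apply: card_minP; exists (nat + (X -> Prop))%type; split.
  by apply/infiniteP/card_leTP; exists inl => m n [].
move=> x; exists [set U | open U /\ U x]; split.
- by move=> U [].
- apply: (card_le_trans (card_leT _)).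
  by apply/card_leTP; exists inr => U V [].
apply/seteqP; split=> [y xy|_ -> U []//]; apply: contrapT => yx.
have op : open (~` [set y]).
  exact/closed_openC/accessible_closed_set1/hausdorff_accessible.
by case: (xy (~` [set y])) => //; split=> // xy'; apply: yx; rewrite xy'.
Qed.

Lemma FhatP (X : topologicalType) :
  is_card_min (fun K => forall A : set X, A #= [set: K] ->
    ~ is_free_sequence A) (Fhat X).
Proof.
apply: card_minP; exists (X -> Prop) => A AX _.
have : [set: X -> Prop] #<= [set: X].
  by rewrite -(card_le_eql AX); exact: card_leT.
move=> /card_leTP[f finj].
pose D := [set x | exists2 B, f B = x & ~ B x].
have [DD|nDD] := pselect (D (f D)); last by apply: (nDD); exists D.
by case: (DD) => B /finj ->; exact.
Qed.

Lemma bsupP (X : topologicalType) :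
  is_card_min (fun Q => forall K : Type, (exists F : set X,
    is_free_sequence F /\ [set: K] #= closure F) -> [set: K] #<= [set: Q])
    (bsup X).
Proof.
apply: card_supP; exists X => K [F [_ KF]].
by rewrite (card_le_eql KF); exact: card_leT.
Qed.

(* Main.v *)
Require Import Defs.
From mathcomp Require Import all_boot.
From mathcomp Require Import all_classical topology.
From mathcomp Require wochoice.

Set Implicit Arguments.
Unset Strict Implicit.
Unset Printing Implicit Defensive.

Local Open Scope classical_set_scope.
Local Open Scope card_scope.

(** Every point is reached along a branch of a tree whose nodes carry closures
of free sequences, and the tree is small enough to be counted.  Let I be the initial well-order
on the continuum, and let every point have a family of at most continuum many
open sets with intersection that point.  For a point p define by recursion
along I two sequences: at stage a the point x_a is chosen outside the
open sets W_b, b < a, chosen so far, by a choice function that depends only on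
their union; then, if p is not in F_a = closure {x_b | b <= a}, the Lindelöf
property provides a countable union W_a of open sets, taken from the families
attached to the points of F_a, that covers F_a and misses p.  Such a W_a
separates {x_b | b <= a} from all later points, so the sequence is free for as
long as p stays outside the sets F_a ([tree_free]).  As free sequences have
fewer than continuum many points, p lies in F_a for some a; take the least
such a.

It remains to count the possible triples (a, path of the W_b with b < a,
position of p in F_a).  Each F_b, b <= a, is the closure of a free sequence
and thus has at most continuum many points, so there are at most continuum
many candidates for W_b ([card_countable_unions_continuum]), and, numbering
them, the path becomes a function from the proper initial segment {b | b < a}
to the continuum, from which it can be recovered by induction
([tree_path_determined]).  The segment has fewer than continuum many elements,
hence so does its product with nat by König's argument
([prod_nat_lt_continuum]), and the hypothesis on powers bounds the number of
such functions by the continuum ([card_pow_lt_continuum]). *)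

(** * Well-orders *)

(* Well-orders are reflexive relations R, so that [~~ R a b] says that b is
   strictly below a. *)

Lemma wo_min (T : Type) (R : rel T) (P : T -> Prop) :
  wochoice.well_order R -> (exists x, P x) ->
  exists2 z, P z & forall x, P x -> R z x.
Proof.
move=> woR [x Px]; have [|z [[/asboolP Pz minz] _]] := woR (fun x => `[< P x >]).
  by exists x; apply/asboolP.
by exists z => // y Py; apply: minz; apply/asboolP.
Qed.

Lemma wo_total (T : Type) (R : rel T) : wochoice.well_order R -> total R.
Proof.
move=> woR x y; have [|z [->|->] minz] := @wo_min _ _ (fun z => z = x \/ z = y) woR.
- by exists x; left.
- by rewrite minz //; right.
- by rewrite orbC minz //; left.
Qed.

Lemma wo_refl (T : Type) (R : rel T) : wochoice.well_order R -> reflexive R.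
Proof. by move=> woR x; rewrite -[R x x]orbb wo_total. Qed.

Lemma wo_antisym (T : Type) (R : rel T) :
  wochoice.well_order R -> antisymmetric R.
Proof.
move=> woR x y /andP[xy yx].
have [|z [_ uz]] := woR (fun z => `[< z = x \/ z = y >]).
  by exists x; apply/asboolP; left.
have uxy t : t = x \/ t = y -> z = t.
  move=> tE; apply: uz; split=> [|u /asboolP uE]; first exact/asboolP.
  by case: tE uE => -> [] -> //; exact: wo_refl.
by rewrite -(uxy x (or_introl erefl)) -(uxy y (or_intror erefl)).
Qed.

Lemma wo_trans (T : Type) (R : rel T) : wochoice.well_order R -> transitive R.
Proof.
move=> woR y x z xy yz.
have [|m mP minm] := @wo_min _ _ (fun m => [\/ m = x, m = y | m = z]) woR.
  by exists x; constructor.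
have [mx my mz] : [/\ R m x, R m y & R m z].
  by split; apply: minm; [constructor 1|constructor 2|constructor 3].
case: mP => mE; move: mx my mz; rewrite {}mE // => mx my mz.
- by rewrite (wo_antisym woR (x := x) (y := y)) // xy.
- by rewrite -(wo_antisym woR (x := y) (y := z)) ?yz.
Qed.

Lemma wo_ltW (T : Type) (R : rel T) a b :
  wochoice.well_order R -> ~~ R a b -> R b a.
Proof. by move=> woR ab; have := wo_total woR a b; rewrite (negPf ab). Qed.

Lemma wo_le_lt_trans (T : Type) (R : rel T) a b c :
  wochoice.well_order R -> R c b -> ~~ R a b -> ~~ R a c.
Proof. by move=> woR cb; apply: contra => ac; exact: wo_trans ac cb. Qed.

Lemma wo_lt_le_trans (T : Type) (R : rel T) a b c :
  wochoice.well_order R -> ~~ R b c -> R b a -> ~~ R a c.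
Proof. by move=> woR bc ba; apply: contra bc; exact: wo_trans ba. Qed.

Lemma wo_preim (S T : Type) (R : rel T) (f : S -> T) :
  wochoice.well_order R -> injective f -> wochoice.well_order (relpre f R).
Proof.
move=> woR finj A [x Ax].
have [|z [y Ay yz] minz] :=
  @wo_min _ _ (fun z => exists2 y, y \in A & f y = z) woR.
  by exists (f x), x.
exists y; split=> [|t [At mint]].
  by split=> // t At; rewrite /= yz; apply: minz; exists t.
have ty : R (f t) (f y) := mint _ Ay.
by apply/finj/(wo_antisym woR); rewrite yz minz -?yz ?ty //; exists t.
Qed.

(** Recursion for equations [W a = H a W] in which [H a] consults only the
    values below a; this extensional form spares dependent recursion later. *)
Lemma wo_rec (T U : Type) (R : rel T) (H : T -> (T -> U) -> U) :
  wochoice.well_order R -> inhabited U ->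
  (forall a f g, (forall b, ~~ R a b -> f b = g b) -> H a f = H a g) ->
  exists W : T -> U, forall a, W a = H a W.
Proof.
move=> woR [u0] Hext.
have wf : well_founded (fun b a => ~~ R a b).
  move=> a; apply: contrapT => na.
  have [|z nz minz] := @wo_min _ _ (fun a => ~ Acc (fun b a => ~~ R a b) a) woR.
    by exists a.
  apply: nz; constructor => b zb; apply: contrapT => nb.
  by have := minz _ nb; rewrite (negPf zb).
pose ext a (f : forall b, ~~ R a b -> U) b :=
  if pselect (~~ R a b) is left h then f b h else u0.
exists (Fix wf (fun=> U) (fun a f => H a (ext a f))) => a.
rewrite Fix_eq; last first.
  move=> c f g fg; apply: Hext => b cb; rewrite /ext.
  by case: pselect => // h; exact: fg.
by apply: Hext => b ab; rewrite /ext; case: pselect.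
Qed.

(** The initial ordinal of T: take the first element a below which T embeds, if
    there is one, and pull the order back along that embedding; a segment of
    size T in the new order would give one below an element smaller than a. *)
Lemma wo_small_segments (T : Type) : exists2 R : rel T, wochoice.well_order R &
  forall a, ~ exists f : T -> {b | ~~ R a b}, injective f.
Proof.
have [R0 wo0] := wochoice.well_ordering_principle {classic T}.
have [|none] := pselect
  (exists a, exists f : T -> {b : {classic T} | ~~ R0 a b}, injective f).
- move=> /(wo_min wo0)[a [f finj] mina].
  exists (relpre (fun x => sval (f x)) R0).
  + by apply: wo_preim => // x y /val_inj /finj.
  + move=> x [g ginj].
    have := svalP (f x); rewrite mina //.
    exists (fun t => exist (fun b => ~~ R0 (sval (f x)) b)
                           (sval (f (sval (g t)))) (svalP (g t))).
    by move=> t u [] /val_inj /finj /val_inj /ginj.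
- by exists R0 => // a fa; apply: none; exists a.
Qed.

(** * Cardinals below the continuum *)

Lemma card_seq_continuum : [set: nat -> continuum] #<= [set: continuum].
Proof.
apply/card_leTP.
exists (fun s n => if @unpickle (nat * nat)%type n is Some (i, j)
                   then s i j else false).
move=> s t st; apply/funext => i; apply/funext => j.
by have := congr1 (@^~ (pickle (i, j))) st; rewrite /= pickleK.
Qed.

Lemma card_prod_continuum : [set: continuum * continuum] #<= [set: continuum].
Proof.
apply: card_le_trans card_seq_continuum; apply/card_leTP.
exists (fun p n => if n is 0 then p.1 else p.2) => -[a b] [c d] E.
by have /= -> := congr1 (@^~ 0) E; have /= -> := congr1 (@^~ 1) E.
Qed.

(** König's diagonal argument: if sequences in the continuum were coded by
    [L * nat], then for each n the sequences with code in [L * {n}] would miss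
    some value c at their n-th entry, and the sequence of these missed values
    would have no code. *)
Lemma prod_nat_lt_continuum (L : Type) :
  ~ ([set: continuum] #<= [set: L]) -> ~ ([set: continuum] #<= [set: L * nat]).
Proof.
move=> CL CLn; have /card_leTP[h hinj] := card_le_trans card_seq_continuum CLn.
have miss n : exists c : continuum, forall s, (h s).2 = n -> s n <> c.
  apply: contrapT => none; apply: CL.
  have /choice[s sP] (c : continuum) : exists s, (h s).2 = n /\ s n = c.
    apply: contrapT => nc; apply: none; exists c => s hs sn.
    by apply: nc; exists s.
  apply/card_leTP; exists (fun c => (h (s c)).1) => c d cd.
  have [hc <-] := sP c; have [hd <-] := sP d; congr (_ n); apply: hinj.
  by rewrite [LHS]surjective_pairing [RHS]surjective_pairing cd hc hd.
by have [y yP] := choice miss; exact: (yP (h y).2 y).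
Qed.

(** Functions from L to the continuum are subsets of [L * nat], which is still
    smaller than the continuum, so that their number is one of the cardinals
    whose supremum is 2^{<c}. *)
Lemma card_pow_lt_continuum (L : Type) :
  [set: two_pow_lt continuum] #= [set: continuum] ->
  [set: L] #<= [set: continuum] -> ~ ([set: continuum] #<= [set: L]) ->
  [set: L -> continuum] #<= [set: continuum].
Proof.
move=> pow LC CL.
apply: (@card_le_trans _ (L * nat -> bool)%type _ setT).
  apply/card_leTP; exists (fun f ln => f ln.1 ln.2) => f g fg.
  by apply/funext => l; apply/funext => n; exact: (congr1 (fun u => u (l, n)) fg).
rewrite -(card_le_eqr pow); apply: (two_pow_ltP continuum).1.
exists (L * nat)%type; split=> //; last 1 first.
- apply: contra_notN (prod_nat_lt_continuum CL).
  by rewrite card_eq_le => /andP[].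
- apply: card_le_trans card_prod_continuum; move/card_leTP: LC => [f finj].
  apply/card_leTP; exists (fun ln => (f ln.1, fun m => m == ln.2)).
  move=> [l n] [k m] [] /finj /= -> /(congr1 (@^~ n)); rewrite eqxx.
  by move=> /esym/eqP ->.
Qed.

Lemma card_bigcup_continuum (I T : Type) (D : set I) (F : I -> set T) :
  D #<= [set: continuum] -> (forall i, D i -> F i #<= [set: continuum]) ->
  \bigcup_(i in D) F i #<= [set: continuum].
Proof.
move=> /pcard_injP[e einj] FC; apply: card_le_trans card_prod_continuum.
have /choice[k kinj] i : exists k : T -> continuum,
    D i -> {in F i &, injective k}.
  have [/FC/pcard_injP[k kinj]|nDi] := pselect (D i); first by exists k.
  by exists (fun=> fun=> false).
have [I0|/existsNP[i0 _]] := pselect (forall i : I, False).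
  rewrite (_ : \bigcup_(i in D) F i = set0) ?card_ge0 // -subset0 => t [i].
  by case: (I0 i).
have /choice[j jP] (t : T) : exists i : I,
    (\bigcup_(i in D) F i) t -> D i /\ F i t.
  have [[i Di Fit]|nt] := pselect ((\bigcup_(i in D) F i) t).
    by exists i.
  by exists i0.
apply/pcard_injP; exists (fun t => (e (j t), k (j t) t)) => t u.
rewrite !inE => /jP[Dt Ft] /jP[Du Fu] [/einj]; rewrite !inE => jtu.
move: Ft; rewrite {}jtu // => Ft; apply: kinj => //; exact: mem_set.
Qed.

Lemma card_le_factors (T U V : Type) :
  inhabited T -> inhabited U -> [set: T * U] #<= [set: V] ->
  [set: T] #<= [set: V] /\ [set: U] #<= [set: V].
Proof.
move=> [t0] [u0] TUV; split; apply: card_le_trans TUV; apply/card_leTP.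
- by exists (fun t => (t, u0)) => t t' [].
- by exists (fun u => (t0, u)) => u u' [].
Qed.

(** A countable family G is recovered from the sequence of the codes of its
    members. *)
Lemma card_countable_unions_continuum (T : Type) (U : set (set T)) :
  U #<= [set: continuum] ->
  [set \bigcup_(V in G) V | G in [set G | G `<=` U /\ countable G]]
    #<= [set: continuum].
Proof.
move=> /pcard_injP[e einj]; apply: card_le_trans (card_image_le _ _) _.
apply: card_le_trans card_seq_continuum.
have /choice[f finj] (G : set (set T)) : exists f : set T -> nat,
    countable G -> {in G &, injective f}.
  have [/countable_injP[f finj]|] := pselect (countable G); first by exists f.
  by exists (fun=> 0).
(* row n codes the member of G numbered n, if any: bit 0 tells whether there
   is one, and the bits after it are those of its code *)
apply/pcard_injP; exists (fun G n m => `[< exists V, [/\ G V, f G V = n &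
  if m is m'.+1 then e V m' else true] >]) => G H.
rewrite !inE => -[GU cG] [HU cH] GH.
wlog suff: G H GU cG HU cH GH / G `<=` H.
  by move=> S; apply/seteqP; split; apply: S.
move=> V GV.
have /(congr1 (@^~ 0))/= := congr1 (@^~ (f G V)) GH.
have -> : `[< exists V', [/\ G V', f G V' = f G V & true] >] by apply/asboolP; exists V.
move=> /esym/asboolP[V' [HV' fV' _]].
suff -> : V = V' by [].
apply: einj; rewrite ?inE; [exact: GU|exact: HU|].
apply/funext => m.
have /(congr1 (@^~ m.+1))/= := congr1 (@^~ (f G V)) GH.
have -> : `[< exists V', [/\ G V', f G V' = f G V & e V' m] >] = e V m.
  apply/asboolP/idP => [[Z [GZ /finj ->]]|eV]; rewrite ?inE //.
  by exists V.
move=> ->; apply/asboolP/idP => [[Z [HZ]]|eV]; last by exists V'.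
by rewrite -fV' => /finj ->; rewrite ?inE.
Qed.

(** * Free sequences *)

(** The closure of an initial segment lies in the open set [W c], whereas all
    later points, and then also their closure, lie in its closed complement.
    Allowing any index set J gives all subsequences at once. *)
Lemma right_separated_free (X : topologicalType) (I : Type) (R : rel I)
    (x : I -> X) (W : I -> set X) (J : set I) :
  wochoice.well_order R ->
  (forall c d, J c -> J d -> ~~ R d c ->
    [/\ open (W c), closure (x @` [set a | R a c]) `<=` W c & ~ W c (x d)]) ->
  is_free_sequence (x @` J).
Proof.
move=> woR sep; exists {a | J a}, (relpre sval R), (fun a => x (sval a)); split.
- by apply: wo_preim => // -[a Ja] [b Jb] /= ab; exact: eq_exist.
- move=> [c Jc] /=; rewrite -subset0 => z [zl zr].
  (* the separating property of W c is available only if some index is above c *)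
  have [_ [[[d Jd] /= dc _] _]] := zr setT filterT.
  have [Wo clW _] := sep _ _ Jc Jd dc.
  have Wz : W c z.
    apply: clW; apply: closureS zl => _ [[a Ja] /= ac <-].
    by exists a.
  have [_ [[[e Je] /= ec <-] We]] := zr (W c) (open_nbhs_nbhs (conj Wo Wz)).
  by have [_ _] := sep _ _ Jc Je ec; exact.
- apply/seteqP; split=> [_ [[a Ja] _ <-]|_ [a Ja <-]]; first by exists a.
  by exists (exist _ a Ja).
Qed.

Lemma free_sequence_card_closure (X : topologicalType) (A : set X) :
  is_free_sequence A -> closure A #<= [set: bsup X].
Proof.
move=> Afree; have [bnd _] := bsupP X.
rewrite -(card_le_eql (card_setT (closure A))).
by apply: bnd; exists A; split=> //; exact: card_setT.
Qed.

Lemma is_free_sequence_set1 (X : topologicalType) (p : X) :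
  is_free_sequence [set p].
Proof.
have [R woR _] := wo_small_segments unit.
rewrite (_ : [set p] = (fun=> p) @` [set: unit]); last first.
  by apply/seteqP; split=> [_ ->|_ [_ _ <-]//]; exists tt.
apply: (right_separated_free (W := fun=> set0) woR) => -[] [] _ _.
by rewrite wo_refl.
Qed.

Lemma is_free_sequence_set0 (X : topologicalType) :
  is_free_sequence (@set0 X).
Proof.
have [R woR _] := wo_small_segments void.
rewrite -(image_set0 (of_void X)).
by apply: (right_separated_free (W := fun=> set0) woR) => -[].
Qed.

(** The empty set is a free sequence, so the least cardinality of sets that are
    not is at least one. *)
Lemma Fhat_inhabited (X : topologicalType) : inhabited (Fhat X).
Proof.
have [nofree _] := FhatP X; apply: contrapT => none.
apply: (nofree set0 _ (is_free_sequence_set0 X)).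
rewrite (_ : [set: Fhat X] = set0) ?card_eq00 // -subset0 => k _.
by apply: none.
Qed.

(** A one-point free sequence has a nonempty closure. *)
Lemma bsup_inhabited (X : topologicalType) : X -> inhabited (bsup X).
Proof.
move=> x; apply: contrapT => none.
have := free_sequence_card_closure (is_free_sequence_set1 x).
have -> : [set: bsup X] = set0 by rewrite -subset0 => k _; exact: none.
move=> /card_le0P cl0; have : closure [set x] x by exact: subset_closure.
by rewrite cl0.
Qed.

(** A subsequence of type [Fhat X] is too long to be free. *)
Lemma Fhat_bound (X : topologicalType) (T : Type) (x : T -> X) :
  [set: Fhat X] #<= [set: T] -> injective x ->
  ~ forall J : set T, is_free_sequence (x @` J).
Proof.
move=> /card_leTP[h hinj] xinj free; have [nofree _] := FhatP X.
apply: (nofree (x @` range h)) (free _).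
apply: (@card_eq_trans _ _ _ _ (range h)).
  by apply: inj_card_eq => s t _ _; exact: xinj.
by apply: inj_card_eq => s t _ _; exact: hinj.
Qed.

(** * Trees of free sequences *)

(** The point x_a and the closed set F_a determined by the open sets V chosen
    along a branch, where chi picks points outside open sets.  The closed set
    goes up to x_a itself, and still both depend only on the part of V strictly
    below a. *)
Definition tree_point (X I : Type) (R : rel I) (chi : set X -> X)
    (V : I -> set X) (a : I) : X :=
  chi (\bigcup_(b in [set b | ~~ R a b]) V b).

Definition tree_closure (X : topologicalType) (I : Type) (R : rel I)
    (chi : set X -> X) (V : I -> set X) (a : I) : set X :=
  closure (tree_point R chi V @` [set b | R b a]).

Lemma eq_tree_point (X I : Type) (R : rel I) (chi : set X -> X)
    (V V' : I -> set X) (a : I) :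
  (forall b, ~~ R a b -> V b = V' b) ->
  tree_point R chi V a = tree_point R chi V' a.
Proof. by move=> VV; congr chi; exact: eq_bigcupr. Qed.

Lemma eq_tree_closure (X : topologicalType) (I : Type) (R : rel I)
    (chi : set X -> X) (V V' : I -> set X) (a : I) :
  wochoice.well_order R -> (forall b, ~~ R a b -> V b = V' b) ->
  tree_closure R chi V a = tree_closure R chi V' a.
Proof.
move=> woR VV; congr closure; apply: eq_imagel => b /= ba.
by apply: eq_tree_point => c bc; apply: VV; exact: wo_lt_le_trans bc ba.
Qed.

Lemma tree_point_outside (X I : Type) (R : rel I) (chi : set X -> X)
    (V : I -> set X) (p : X) (a b : I) :
  (forall U, ~ U p -> ~ U (chi U)) -> (forall c, ~ V c p) -> ~~ R a b ->
  ~ V b (tree_point R chi V a).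
Proof.
move=> chiP Vp ab Vba; apply: (chiP (\bigcup_(b in [set b | ~~ R a b]) V b)).
  by move=> [c _]; exact: Vp.
by exists b.
Qed.

(** The witness p shows that the sets chosen so far never cover the space, so
    the next point can be taken outside all of them. *)
Lemma tree_free (X : topologicalType) (I : Type) (R : rel I)
    (chi : set X -> X) (V : I -> set X) (p : X) (J : set I) :
  wochoice.well_order R ->
  (forall U, ~ U p -> ~ U (chi U)) -> (forall c, ~ V c p) ->
  (forall c d, J c -> J d -> ~~ R d c ->
    open (V c) /\ tree_closure R chi V c `<=` V c) ->
  is_free_sequence (tree_point R chi V @` J).
Proof.
move=> woR chiP Vp VJ; apply: (right_separated_free (W := V) woR) => c d Jc Jd dc.
by have [Vo cV] := VJ c d Jc Jd dc; split=> //; exact: tree_point_outside chiP Vp dc.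
Qed.

(** At the first difference of two branches their closed sets would still be
    equal, hence so would be the family of candidates and the numbering under
    which the next choices have the same code. *)
Lemma tree_path_determined (X : topologicalType) (I : Type) (R : rel I)
    (chi : set X -> X) (C : Type) (N : set X -> set (set X))
    (code : set X -> set X -> C) (V V' : I -> set X) (a : I) :
  wochoice.well_order R ->
  (forall b, ~~ R a b ->
    [/\ {in N (tree_closure R chi V b) &,
          injective (code (tree_closure R chi V b))},
        N (tree_closure R chi V b) (V b) &
        N (tree_closure R chi V' b) (V' b)]) ->
  (forall b, ~~ R a b ->
    code (tree_closure R chi V b) (V b) =
    code (tree_closure R chi V' b) (V' b)) ->
  forall b, ~~ R a b -> V b = V' b.
Proof.
move=> woR NV cV b0 ab0; apply: contrapT => nb0.
have [|b [ab nb] minb] := @wo_min _ _ (fun b => ~~ R a b /\ V b <> V' b) woR.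
  by exists b0.
have E : tree_closure R chi V b = tree_closure R chi V' b.
  apply: eq_tree_closure => // c bc; apply: contrapT => nc.
  move/negP: (bc); apply; apply: minb; split=> //.
  exact: wo_le_lt_trans (wo_ltW woR bc) ab.
have [cinj Nb Nb'] := NV b ab; rewrite -E in Nb'.
apply: nb; apply: cinj; rewrite ?inE //.
by rewrite cV // E.
Qed.

(** Only F has to be covered, but adding its complement turns a cover of F into
    one of the whole space. *)
Lemma lindelof_cover_avoiding (X : topologicalType) (F : set X) (p : X)
    (U : set (set X)) :
  lindelof_space X -> closed F -> U `<=` open -> ~ F p ->
  (forall x, F x -> exists2 V, U V & V x /\ ~ V p) ->
  exists G, [/\ G `<=` U, countable G, F `<=` \bigcup_(V in G) V &
                ~ (\bigcup_(V in G) V) p].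
Proof.
move=> lX cF Uo Fp FU.
pose U' := [set V | U V /\ ~ V p].
have [||G [GU cG GX]] := lX (U' `|` [set ~` F]).
- by move=> V [[/Uo]//|->]; exact: closed_openC.
- apply/seteqP; split=> // x _; have [/FU[V UV [Vx Vp]]|nFx] := pselect (F x).
    by exists V => //; left.
  by exists (~` F) => //; right.
exists (G `&` U'); split.
- by move=> V [_ []].
- by apply: sub_countable cG; apply: subset_card_le => V [].
- move=> x Fx; have : (\bigcup_(V in G) V) x by rewrite GX.
  move=> [V GV Vx]; exists V => //; split=> //.
  by have [//|VF] := GU V GV; move: Vx; rewrite VF.
- by move=> [V [_ [_ Vp]]].
Qed.

Theorem theorem3p8 (X : topologicalType) :
  [set: two_pow_lt continuum] #= [set: continuum] ->
  hausdorff_space X ->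
  lindelof_space X ->
  [set: pseudocharacter X] #<= [set: continuum] ->
  [set: (Fhat X * bsup X)%type] #<= [set: continuum] ->
  [set: X] #<= [set: continuum].
Proof.
move=> pow hX lX psiX FbX.
have [X0|/existsNP[x0 _]] := pselect (forall x : X, False).
  by rewrite (_ : [set: X] = set0) ?card_ge0 // -subset0 => x; case: (X0 x).
have [FC bC] : [set: Fhat X] #<= [set: continuum] /\
               [set: bsup X] #<= [set: continuum].
  apply: card_le_factors FbX; first exact: Fhat_inhabited.
  exact: bsup_inhabited x0.
have clC (A : set X) : is_free_sequence A -> closure A #<= [set: continuum].
  by move=> /free_sequence_card_closure cA; exact: card_le_trans cA bC.
have /choice[B BP] (x : X) : exists B : set (set X),
    [/\ B `<=` open, B #<= [set: continuum] & \bigcap_(U in B) U = [set x]].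
  have [[_ /(_ x)[B [Bo BK Bx]]] _] := pseudocharacterP hX.
  by exists B; split=> //; exact: card_le_trans BK psiX.
(* the open sets that may be chosen when the current closed set is F *)
pose N (F : set X) := [set \bigcup_(V in G) V |
  G in [set G | G `<=` \bigcup_(x in F) B x /\ countable G]].
have NC F : F #<= [set: continuum] -> N F #<= [set: continuum].
  move=> FC'; apply/card_countable_unions_continuum/card_bigcup_continuum => //.
  by move=> x _; have [] := BP x.
have No F V : N F V -> open V.
  move=> [G [GB _] <-]; apply: bigcup_open => U /GB[x _].
  by have [+ _ _] := BP x; exact.
(* the choice of an open set for F and p; as it misses p even when p is in F, p
   stays outside all the sets on its branch *)
have /choice[w0 w0P] (Fp : set X * X) : exists w : set X,
    ~ w Fp.2 /\ (closed Fp.1 -> ~ Fp.1 Fp.2 -> N Fp.1 w /\ Fp.1 `<=` w).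
  case: Fp => F p /=.
  have [Fp|nFp] := pselect (closed F /\ ~ F p); last first.
    by exists set0; split=> // cF Fp; case: nFp.
  have [|x Fx|G [GB cG FG nGp]] :=
      @lindelof_cover_avoiding X F p (\bigcup_(x in F) B x) lX Fp.1 _ Fp.2.
  - by move=> U [x _]; have [+ _ _] := BP x; exact.
  - have [_ _ Bx] := BP x.
    have nBp : ~ (\bigcap_(U in B x) U) p by rewrite Bx => px; case: Fp; rewrite px.
    have [U BU Up] : exists2 U, B x U & ~ U p.
      apply: contrapT => none; apply: nBp => U BU; apply: contrapT => Up.
      by apply: none; exists U.
    exists U; first by exists x.
    split=> //; have : (\bigcap_(U in B x) U) x by rewrite Bx.
    exact.
  by exists (\bigcup_(V in G) V); split=> // _ _; split=> //; exists G.
(* chi V is outside V unless V covers the space *)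
have /choice[chi chiP] (V : set X) : exists x, forall p, ~ V p -> ~ V x.
  have [[x nVx]|none] := pselect (exists x, ~ V x); first by exists x.
  by exists x0 => p nVp; case: none; exists p.
have [R woR small] := wo_small_segments continuum.
(* the branch of p: the closed set at stage a depends only on the open sets
   chosen before a, which makes this a definition by recursion *)
have /choice[W WP] (p : X) : exists V : continuum -> set X,
    forall a, V a = w0 (tree_closure R chi V a, p).
  apply: (@wo_rec _ _ R (fun a V => w0 (tree_closure R chi V a, p)) woR).
    by constructor; exact: set0.
  by move=> a f g /(eq_tree_closure chi woR) ->.
have Wp p a : ~ W p a p by rewrite WP; case: (w0P (tree_closure R chi (W p) a, p)).
have Wgood p a : ~ tree_closure R chi (W p) a p ->
    N (tree_closure R chi (W p) a) (W p a) /\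
    tree_closure R chi (W p) a `<=` W p a.
  move=> na; have [_] := w0P (tree_closure R chi (W p) a, p).
  by rewrite -WP; apply=> //; exact: closed_closure.
have free p J : (forall c d, J c -> J d -> ~~ R d c ->
    ~ tree_closure R chi (W p) c p) ->
    is_free_sequence (tree_point R chi (W p) @` J).
  move=> Jgood; apply: (tree_free woR (p := p)) => // [U|c d Jc Jd dc].
    exact: chiP.
  by have [/No ? ?] := Wgood _ _ (Jgood c d Jc Jd dc); split.
(* the least stage at which p is captured: if there were none, the branch of p
   would give an injective free sequence of length continuum *)
have /choice[a aP] (p : X) : exists a, tree_closure R chi (W p) a p /\
    forall b, ~~ R a b -> ~ tree_closure R chi (W p) b p.
  have [ex|none] := pselect (exists a, tree_closure R chi (W p) a p).
    have [a ap mina] := wo_min woR ex; exists a; split=> // b.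
    by move=> ab bp; rewrite mina in ab.
  have good c : ~ tree_closure R chi (W p) c p by move=> cp; apply: none; exists c.
  exfalso; apply: (Fhat_bound (x := tree_point R chi (W p)) FC); last first.
    by move=> J; apply: free.
  move=> c d.
  wlog cd : c d / ~~ R d c.
    move=> S cd; have [|/S/(_ cd)//] := boolP (R d c) => dc.
    have [|/S/(_ (esym cd))//] := boolP (R c d) => cd'.
    by apply: (wo_antisym woR); rewrite dc cd'.
  move=> E; have := tree_point_outside (fun U => chiP U p) (Wp p) cd.
  rewrite -E => nWc; case: nWc.
  apply: (Wgood p c (good c)).2; apply: subset_closure.
  by exists c => //=; exact: wo_refl.
(* up to the stage of capture, the closed sets on the branch are closures of
   free sequences *)
have closC p b : R b (a p) -> tree_closure R chi (W p) b #<= [set: continuum].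
  move=> ba; apply/clC/free => c d /= cb db dc; apply: (aP p).2.
  exact: wo_lt_le_trans dc (wo_trans woR db ba).
(* numberings of the candidates for the next open set and of the points of F;
   they depend on F alone, and not on the point whose branch has reached F *)
have /choice[eN eNinj] (F : set X) : exists e : set X -> continuum,
    F #<= [set: continuum] -> {in N F &, injective e}.
  have [/NC/pcard_injP[e einj]|?] := pselect (F #<= [set: continuum]).
    by exists e.
  by exists (fun=> fun=> false).
have /choice[eF eFinj] (F : set X) : exists e : X -> continuum,
    F #<= [set: continuum] -> {in F &, injective e}.
  have [/pcard_injP[e einj]|?] := pselect (F #<= [set: continuum]).
    by exists e.
  by exists (fun=> fun=> false).
have paths (b : continuum) :
    exists e : ({c | ~~ R b c} -> continuum) -> continuum, injective e.
  apply/card_leTP; apply: card_pow_lt_continuum => //.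
    by apply/card_leTP; exists sval => x y /val_inj.
  by move=> /card_leTP /small.
pose eP b := sval (cid (paths b)).
have ePinj b : injective (eP b) := svalP (cid (paths b)).
apply: card_le_trans card_prod_continuum.
apply: (@card_le_trans _ (continuum * (continuum * continuum))%type _ setT); last first.
  have /card_leTP[f finj] := card_prod_continuum.
  by apply/card_leTP; exists (fun x => (x.1, f x.2)) => -[x y] [z t] [/= -> /finj ->].
(* p is recovered from its stage of capture, its path of choices below that
   stage, and its position in the closed set that the path determines *)
apply/card_leTP.
exists (fun p => (a p, (
  eP (a p) (fun c => eN (tree_closure R chi (W p) (sval c)) (W p (sval c))),
  eF (tree_closure R chi (W p) (a p)) p))) => p q [/=].
have [ap pmin] := aP p; have [aq qmin] := aP q.
move: (closC p) (closC q) ap pmin aq qmin.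
move: (a p) (a q) => b b' clp clq bp pmin bq qmin bb'; subst b'.
move=> /ePinj codes.
have VV : forall c, ~~ R b c -> W p c = W q c.
  apply: (@tree_path_determined _ _ R chi _ N eN) => // c bc.
    split; first by apply/eNinj/clp/wo_ltW.
      by apply: (Wgood p c _).1; exact: pmin.
    by apply: (Wgood q c _).1; exact: qmin.
  exact: (congr1 (fun u => u (exist _ c bc)) codes).
rewrite -(eq_tree_closure chi woR VV) in bq * => /eFinj.
by rewrite !inE; apply=> //; exact/clp/wo_refl.
Qed.
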